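(* Let $d$ be any right-infinite sequence over a finite alphabet, with complexity sequence $\{\Phi_n(d)\}_{n\ge 1}$. Then there exists a real $\beta>1$ such that $|P_{X_\beta}(n)|=\Phi_n(d)+1$ for every positive integer $n$; that is, $\{\Phi_n(d)+1\}_{n\ge1}$ is the predecessor set sequence of the $\beta$-shift $X_\beta$.
   Context: Let $\beta>1$ be real. For $x\in[0,1)$, $d_\beta(x)=.x_1x_2x_3\ldots$ is the lexicographically largest sequence over $\{0,1,\ldots,\lfloor\beta\rfloor\}$ with $x=\sum_{n\ge1}x_n\beta^{-n}$ (the greedy expansion, $x_i=\lfloor \beta\, T_\beta^{i-1}(x)\rfloor$ with $T_\beta(x)=\beta x \bmod 1$). The one-sided $\beta$-shift is $X_\beta=\overline{d_\beta([0,1))}$ (closure in the product topology). Put $d_\beta^*(1)=\lim_{x\nearrow 1}d_\beta(x)$. Equivalently (Parry), a sequence $x$ over $\{0,\ldots,\lfloor\beta\rfloor\}$ is in $X_\beta$ iff $\sigma^i(x)\preceq d_\beta^*(1)$ for all $i\ge 0$, where $\sigma$ is the left shift and $\preceq$ is lexicographic order. For a shift $X$, $L(X)$ is the set of finite words appearing in points of $X$, and $L_n(X)$ is the set of those of length $n$. The predecessor set of $w\in L(X)$ is $P_X(w)=\{s\in L(X): sw\in L(X)\}$. For a positive integer $n$, $P_X(n)=\{P_X(w): w\in L_n(X)\}$, so $|P_X(n)|$ is the number of distinct predecessor sets of words of length $n$. For a right-infinite sequence $d$, $\Phi_n(d)$ is the number of distinct words of length $n$ occurring as (contiguous) subwords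 of $d$. *)

(* Defs.v *)
From mathcomp Require Import all_boot all_order all_algebra.
From mathcomp Require Import all_classical all_reals all_analysis.
Import Order.TTheory GRing.Theory Num.Theory numFieldNormedType.Exports.

Set Implicit Arguments.
Unset Strict Implicit.
Unset Printing Implicit Defensive.

Local Open Scope classical_set_scope.
Local Open Scope ring_scope.

(* A right-infinite sequence x_1 x_2 x_3 ... is represented by a function on
   nat, so that [x n] is the digit x_(n+1); finite words are of type [seq T]. *)

Definition subword (T : Type) (x : nat -> T) (w : seq T) : Prop :=
  exists i : nat, w = mkseq (fun j => x (i + j)%N) (size w).

Definition complexity (A : finType) (d : nat -> A) (n : nat) : nat :=
  #|[set w : n.-tuple A | `[< subword d w >]]%SET|.

Definition language (T : Type) (X : set (nat -> T)) : set (seq T) :=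
  [set w | exists2 x, X x & subword x w].

Definition language_of_size (T : Type) (X : set (nat -> T)) (n : nat) :
    set (seq T) :=
  [set w | language X w /\ size w = n].

Definition predecessor_set (T : Type) (X : set (nat -> T)) (w : seq T) :
    set (seq T) :=
  [set s | language X s /\ language X (s ++ w)].

Definition predecessor_sets (T : Type) (X : set (nat -> T)) (n : nat) :
    set (set (seq T)) :=
  [set predecessor_set X w | w in language_of_size X n].

Definition lexi_le (s t : nat -> nat) : Prop :=
  s = t \/ exists2 k : nat, (forall i, (i < k)%N -> s i = t i) & (s k < t k)%N.

Definition beta_expansion (R : realType) (beta x : R) (s : nat -> nat) : Prop :=
  (forall n, (s n <= Num.truncn beta)%N) /\
  series (fun n => (s n)%:R / beta ^+ n.+1) @ \oo --> x.

Definition greedy_expansion (R : realType) (beta x : R) (s : nat -> nat) :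
    Prop :=
  beta_expansion beta x s /\ forall t, beta_expansion beta x t -> lexi_le t s.

(* The closure is taken in the countable product of copies of the discrete
   space nat; this is the same as the closure in the space of sequences over
   {0, ..., floor beta}, which is a closed subspace. *)
Definition beta_shift (R : realType) (beta : R) : set {ptws nat -> nat} :=
  closure [set s : {ptws nat -> nat} |
            exists2 x : R, 0 <= x < 1 & greedy_expansion beta x s].

(* Main.v *)
(* Choose an integer M and code the letters of d by digits in [1, M - 1]; the
   sequence e = M d strictly dominates its shifts, so e = d*_beta(1) for
   some beta: the tails of e have values t_0 = 1 and 0 < t_k < 1 for k > 0.
   Writing wval for the value of a word in base beta, a word belongs to the
   language of the beta-shift iff all its suffixes have wval < 1, and on
   such words wval orders words of equal length lexicographically. The
   predecessor set of w is determined by {k | wval w < t_k}, hence by the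
   least factor of e of length |w| that is at least w; so predecessor sets
   of words of length n correspond to the factors of e of length n, which
   are the factors of d and the prefix starting with M. *)

Require Import Defs.
From mathcomp Require Import all_boot all_order all_algebra.
From mathcomp Require Import all_classical all_reals all_analysis.
From mathcomp Require Import ring lra.
Import Order.TTheory GRing.Theory Num.Theory numFieldNormedType.Exports.
Local Open Scope classical_set_scope.
Local Open Scope ring_scope.
Local Open Scope card_scope.

Set Implicit Arguments.
Unset Strict Implicit.
Unset Printing Implicit Defensive.

(** * Values of finite words *)

Section Words.
Context {R : realType}.
Implicit Types (b : R) (w u : seq nat) (s : nat -> nat).

(** The Horner form of the sum of [a_i b^i] over the letters [a_1 a_2 ...] of [w]; here [b] stands
    for the reciprocal of the base. *)
Definition wval b w : R := foldr (fun a r => (a%:R + r) * b) 0 w.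

Lemma wval_nil b : wval b [::] = 0. Proof. by []. Qed.

Lemma wval_cons b a w : wval b (a :: w) = (a%:R + wval b w) * b. Proof. by []. Qed.

Definition factor s k n : seq nat := mkseq (fun j => s (k + j)%N) n.

Lemma size_factor s k n : size (factor s k n) = n.
Proof. exact: size_mkseq. Qed.

Lemma factorS s k n : factor s k n.+1 = s k :: factor s k.+1 n.
Proof.
rewrite /factor /mkseq /= addn0; congr (_ :: _).
by rewrite -[1%N]addn0 iotaDl -map_comp; apply: eq_map => j /=; rewrite addnA addn1.
Qed.

Lemma factor_cat s k m n : factor s k (m + n) = factor s k m ++ factor s (k + m) n.
Proof.
by elim: m k => [|m IH] k; [rewrite addn0 | rewrite addSn !factorS IH addSnnS].
Qed.

Lemma drop_factor s k i n : drop i (factor s k n) = factor s (k + i) (n - i).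
Proof.
have [le_in | /ltnW le_ni] := leqP i n.
  rewrite -{1}(subnKC le_in) factor_cat drop_size_cat ?size_factor //.
by rewrite drop_oversize ?size_factor // (eqP le_ni).
Qed.

Lemma eq_factor s s' k n :
  (forall j, (j < n)%N -> s (k + j)%N = s' (k + j)%N) -> factor s k n = factor s' k n.
Proof. by move=> ss'; apply/eq_in_map => j; rewrite mem_iota => /andP[_ /ss']. Qed.

Section Nonnegative.
Variable b : R.
Hypothesis b0 : 0 <= b.

Lemma wval_ge0 w : 0 <= wval b w.
Proof. by elim: w => //= a w IH; rewrite mulr_ge0 // addr_ge0. Qed.

Lemma wval_cat u w : wval b (u ++ w) = wval b u + b ^+ size u * wval b w.
Proof.
elim: u => [|a u IH] /=; first by rewrite expr0 mul1r add0r.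
by rewrite IH exprS; ring.
Qed.

Lemma wval_le_cat u w : wval b u <= wval b (u ++ w).
Proof. by rewrite wval_cat lerDl mulr_ge0 ?exprn_ge0 ?wval_ge0. Qed.

(** Prepending a digit at most [m] applies a map dominated by [r -> (m + r) b], which keeps values
    at most [C]. *)
Lemma wval_le w (m : nat) (C : R) :
  0 <= C -> (m%:R + C) * b <= C -> all (fun a => a <= m)%N w -> wval b w <= C.
Proof.
move=> C0 mC; elim: w => //= a w IH /andP[am /IH wC].
by apply: le_trans mC; rewrite ler_wpM2r // lerD // ler_nat.
Qed.

End Nonnegative.

(** The constant does not depend on the length of [w]: since [x <= 1/2], word values are at most
    [m], so a new digit contributes at most [2m (x - y)], while the old error is at least halved. *)
Lemma wval_lipschitz w (m : nat) x y :
  0 <= y -> y <= x -> x <= 2^-1 -> all (fun a => a <= m)%N w ->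
  wval x w - wval y w <= 4 * m%:R * (x - y).
Proof.
move=> y0 yx x2; have x0 := le_trans y0 yx.
have m0 : 0 <= m%:R :> R by [].
elim: w => [|a w IH] /=; first by rewrite subrr mulr_ge0 ?mulr_ge0 ?subr_ge0.
move=> /andP[am wm]; have {IH} := IH wm.
have : wval x w <= m%:R.
  by apply: (wval_le x0 m0 _ wm); nra.
have : 0 <= wval x w by exact: wval_ge0.
have : a%:R <= m%:R :> R by rewrite ler_nat.
have : 0 <= a%:R :> R by [].
move: (wval x w) (wval y w) (a%:R : R) => p q c c0 cm p0 pm pq.
have xy : 0 <= x - y by rewrite subr_ge0.
have h1 : (c + p) * (x - y) <= (m%:R + m%:R) * (x - y) by rewrite ler_wpM2r // lerD.
have h2 : (p - q) * y <= 4 * m%:R * (x - y) * y by rewrite ler_wpM2r.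
have h3 : 4 * m%:R * (x - y) * y <= 4 * m%:R * (x - y) * 2^-1.
  by rewrite ler_wpM2l ?(le_trans yx) // !mulr_ge0.
lra.
Qed.

End Words.

Arguments factor : simpl never.
Arguments wval : simpl never.

Lemma natr_add_lt {R : realType} (a c : nat) (r t : R) :
  (a < c)%N -> r < 1 -> 0 <= t -> a%:R + r < c%:R + t.
Proof.
move=> ac r1 t0; have : a.+1%:R <= c%:R :> R by rewrite ler_nat.
by rewrite -natr1 => ?; lra.
Qed.

Lemma seq_argmin {R : realType} (T : eqType) (s : seq T) (p : pred T) (f : T -> R) x :
  x \in s -> p x ->
  exists2 y, (y \in s) && p y & forall z, z \in s -> p z -> f y <= f z.
Proof.
move=> xs px.
have Ei (z : T) : z \in s -> exists i : 'I_(size s), tnth (in_tuple s) i = z.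
  move=> zs; exists (Ordinal (etrans (index_mem z s) zs)).
  by rewrite (tnth_nth z) /= nth_index.
have [i0 i0x] := Ei x xs.
pose i := [arg min_(i < i0 | p (tnth (in_tuple s) i)) f (tnth (in_tuple s) i)]%O.
exists (tnth (in_tuple s) i).
  by rewrite /i; case: arg_minP => [|j pj _]; rewrite ?i0x // pj andbT mem_tnth.
move=> z /Ei[j <-] pj; rewrite /i; case: arg_minP => [|j' _]; rewrite ?i0x //.
exact.
Qed.

(** * Admissible words and their order *)

Section Admissible.
Context {R : realType}.
Variable b : R.
Hypothesis b0 : 0 < b.
Let b0' : 0 <= b := ltW b0.

Definition admissible (w : seq nat) : Prop := forall i, wval b (drop i w) < 1.

Lemma admissible_behead a w : admissible (a :: w) -> admissible w.
Proof. by move=> aw i; exact: (aw i.+1). Qed.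

Lemma admissible_lt1 w : admissible w -> wval b w < 1.
Proof. by move=> /(_ 0%N); rewrite drop0. Qed.

(** Tails have value below 1, so unequal first digits force unequal values. Equal sizes matter
    because trailing zeros do not change the value. *)
Lemma wval_inj w w' : admissible w -> admissible w' -> size w = size w' ->
  wval b w = wval b w' -> w = w'.
Proof.
elim: w w' => [|a w IH] [|a' w'] //= aw aw' [sw]; rewrite !wval_cons.
move=> /(mulIf (lt0r_neq0 b0)) E.
have w1 := admissible_lt1 (admissible_behead aw).
have w1' := admissible_lt1 (admissible_behead aw').
have [aa'|aa'|aa'] := ltngtP a a'.
- by have := natr_add_lt aa' w1 (wval_ge0 b0' w'); rewrite E ltxx.
- by have := natr_add_lt aa' w1' (wval_ge0 b0' w); rewrite E ltxx.
subst a'; congr (_ :: _); apply: IH sw _; last exact: addrI E.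
  exact: admissible_behead aw.
exact: admissible_behead aw'.
Qed.

(** * Comparison of words with a sequence [e] whose tails have values [t] *)

Section QuasiGreedy.
Variables (e : nat -> nat) (t : nat -> R).
Hypothesis te : forall k, t k = ((e k)%:R + t k.+1) * b.
Hypothesis t_gt0 : forall k, 0 < t k.
Hypothesis t0 : t 0%N = 1.
Hypothesis t_lt1 : forall k, t k.+1 < 1.

Lemma tail_le1 k : t k <= 1.
Proof. by case: k => [|k]; rewrite ?t0 // ltW. Qed.

Lemma wval_factor k n : t k = wval b (factor e k n) + b ^+ n * t (k + n)%N.
Proof.
elim: n k => [|n IH] k; first by rewrite /= expr0 addn0 mul1r add0r.
by rewrite factorS wval_cons te (IH k.+1) addSnnS exprS; ring.
Qed.

(** Both sides share the value of the factor; what remains is scaled by [b ^+ n > 0]. *)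
Lemma wval_factor_cat_lt k n w :
  (wval b (factor e k n ++ w) < t k) = (wval b w < t (k + n)%N).
Proof.
by rewrite (wval_factor k n) wval_cat size_factor ltrD2l ltr_pM2l // exprn_gt0.
Qed.

Lemma wval_factor_lt k n : wval b (factor e k n) < t k.
Proof. by rewrite -[factor e k n]cats0 wval_factor_cat_lt. Qed.

Lemma admissible_factor k n : admissible (factor e k n).
Proof.
move=> i; rewrite drop_factor.
exact: lt_le_trans (wval_factor_lt _ _) (tail_le1 _).
Qed.

(* On admissible words [wval] orders like the lexicographic order, so that
   [wval b w < t k] says [w <= e_k .. e_(k + n - 1)] lexicographically. *)
Lemma wval_le_factor w k : admissible w -> wval b w < t k ->
  wval b w <= wval b (factor e k (size w)).
Proof.
elim: w k => [|a w IH] k //= aw. rewrite factorS te !wval_cons ltr_pM2r // ler_pM2r //.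
have w1 := admissible_lt1 (admissible_behead aw).
move=> lt_w; have [ae|ea|ae] := ltngtP a (e k).
- by rewrite ltW // natr_add_lt // wval_ge0.
- have /ltW := natr_add_lt ea (t_lt1 k) (wval_ge0 b0' w).
  by move/(lt_le_trans lt_w); rewrite ltxx.
- rewrite ae lerD2l IH //; first exact: admissible_behead aw.
  by move: lt_w; rewrite ae ltrD2l.
Qed.

(** At the first digit where [u] differs from [e] read from [k], the digit of [u] must be smaller,
    and the remainder, of value below 1, cannot make up for it. If there is no such digit, the last
    hypothesis decides. *)
Lemma wval_cat_lt u w k :
  (forall i, (i < size u)%N -> wval b (drop i.+1 u ++ w) < 1) ->
  wval b u < t k -> (u = factor e k (size u) -> wval b w < t (k + size u)%N) ->
  wval b (u ++ w) < t k.
Proof.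
elim: u k => [|a u IH] k /= uw1 ut ue; first by rewrite -[k]addn0 ue.
move: ut; rewrite te !wval_cons ltr_pM2r // ltr_pM2r // => ut.
have [ae|ea|ae] := ltngtP a (e k).
- by apply: natr_add_lt ae _ (ltW (t_gt0 _)); have := uw1 0%N; rewrite drop0; apply.
- have /ltW := natr_add_lt ea (t_lt1 k) (wval_ge0 b0' u).
  by move/(lt_le_trans ut); rewrite ltxx.
- rewrite ae ltrD2l; apply: IH => [i iu||ueq].
  + exact: (uw1 i.+1).
  + by move: ut; rewrite ae ltrD2l.
  + by rewrite addSnnS; apply: ue; rewrite factorS ae -ueq.
Qed.

(** Only the suffixes of [u] that are prefixes of [e] constrain [w]: any other suffix already falls
    below [e] at some digit. Hence [w] matters only through its comparisons with the numbers
    [t k]. *)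
Lemma admissible_catP u w : admissible u -> admissible w ->
  admissible (u ++ w) <->
  (forall i, (i <= size u)%N -> drop i u = factor e 0 (size u - i) ->
     wval b w < t (size u - i)%N).
Proof.
move=> au aw; split=> [uw i iu due | H].
  rewrite -[X in t X]add0n -wval_factor_cat_lt t0 -due.
  have [lt_iu | le_ui] := ltnP i (size u).
    by have := uw i; rewrite drop_cat lt_iu.
  by rewrite drop_oversize //; exact: admissible_lt1 aw.
have {}H v i : drop i u = v -> wval b (v ++ w) < 1.
  (* Induction on the length of the suffix, since [wval_cat_lt] asks that shorter suffixes followed
     by [w] already have value below 1. *)
  elim: {v}(size v) {-2}v (leqnn (size v)) i => [|n IH] v vn i duv.
    by move: vn; rewrite leqn0 => /nilP ->; exact: admissible_lt1 aw.
  rewrite -t0; apply: wval_cat_lt => [j jv||vE].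
  - apply: (IH _ _ (j.+1 + i)%N); last by rewrite -duv drop_drop.
    by rewrite size_drop leq_subLR addSn (leq_trans vn) // ltnS leq_addl.
  - by rewrite t0 -duv; exact: au.
  - have sv : size v = (size u - i)%N by rewrite -duv size_drop.
    rewrite sv add0n; have [iu | /ltnW] := leqP i (size u).
      by apply: H => //; rewrite duv -sv.
    by rewrite -subn_eq0 => /eqP ->; rewrite t0; exact: admissible_lt1 aw.
move=> i; rewrite drop_cat; case: ifP => iu; first exact: H erefl.
exact: aw.
Qed.

(** * Counting predecessor sets *)

Section PredecessorSets.
Variable X : set (nat -> nat).
Hypothesis langX : forall w, language X w <-> admissible w.

(* The prefix of length [k] of [e] precedes [w] exactly when [wval b w < t k]. *)
Lemma predecessor_set_eqP w w' : admissible w -> admissible w' ->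
  predecessor_set X w = predecessor_set X w' <->
  (forall k, (wval b w < t k) = (wval b w' < t k)).
Proof.
have prefixP v k : admissible v ->
    predecessor_set X v (factor e 0 k) <-> wval b v < t k.
  move=> av; rewrite -[k in t k]add0n -wval_factor_cat_lt t0; split.
    by move=> [_ /langX /admissible_lt1].
  rewrite -{1}t0 wval_factor_cat_lt => vt; split; apply/langX.
    exact: admissible_factor.
  move=> i; have [ik | ki] := ltnP i k; last first.
    by rewrite drop_cat size_factor ltnNge ki; exact: av.
  rewrite drop_cat size_factor ik drop_factor (lt_le_trans _ (tail_le1 (0 + i))) //.
  by rewrite wval_factor_cat_lt -addnA (subnKC (ltnW ik)).
move=> aw aw'; split=> [PE k | KE].
  by apply/idP/idP => /prefixP; [rewrite PE | rewrite -PE] => /(_ _)/prefixP; exact.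
apply/seteqP; split=> u [/langX au /langX].
  move=> /(admissible_catP au aw) H; split; apply/langX => //.
  by apply/(admissible_catP au aw') => i iu /(H i iu); rewrite KE.
move=> /(admissible_catP au aw') H; split; apply/langX => //.
by apply/(admissible_catP au aw) => i iu /(H i iu); rewrite KE.
Qed.

(** Each factor lies below its own tail value, hence also below that of the other; [wval_le_factor]
    then bounds each factor by the other. *)
Lemma predecessor_set_factor_inj n k k' :
  predecessor_set X (factor e k n) = predecessor_set X (factor e k' n) ->
  factor e k n = factor e k' n.
Proof.
move/predecessor_set_eqP => /(_ (admissible_factor _ _) (admissible_factor _ _)) KE.
apply: wval_inj; rewrite ?size_factor //; try exact: admissible_factor.
have le j j' : wval b (factor e j n) < t j' ->
    wval b (factor e j n) <= wval b (factor e j' n).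
  by move/(wval_le_factor (admissible_factor j n)); rewrite size_factor.
by apply/le_anti; rewrite !le // ?KE ?wval_factor_lt // -KE wval_factor_lt.
Qed.

(** Rounding a word up to the least factor of [e] above it keeps its predecessor set, and distinct
    factors have distinct predecessor sets. *)
Lemma card_predecessor_sets n (ws : seq (seq nat)) :
  uniq ws -> (forall w, w \in ws <-> exists k, w = factor e k n) ->
  (predecessor_sets X n #= `I_(size ws))%card.
Proof.
move=> Uws wsP.
have -> : predecessor_sets X n =
    (fun i => predecessor_set X (nth [::] ws i)) @` `I_(size ws).
  apply/seteqP; split=> [_ [w [/langX aw sw] <-] | _ [i iws <-]]; last first.
    have /wsP[k wk] := mem_nth [::] iws; exists (nth [::] ws i) => //.
    split; rewrite wk ?size_factor //.
    by apply/langX; exact: admissible_factor.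
  have w_le k : wval b w < t k -> wval b w <= wval b (factor e k n).
    by rewrite -sw; exact: wval_le_factor.
  (* The prefix of [e] is a candidate, since [wval b w < 1 = t 0]. *)
  have [v /andP[vws wv] vmin] : exists2 v, (v \in ws) && (wval b w <= wval b v) &
      forall z, z \in ws -> wval b w <= wval b z -> wval b v <= wval b z.
    apply: (@seq_argmin _ _ ws _ _ (factor e 0 n)); first by apply/wsP; exists 0%N.
    by apply: w_le; rewrite t0; exact: admissible_lt1.
  exists (index v ws); first by rewrite /= index_mem.
  rewrite nth_index //; have /wsP[k vk] := vws.
  apply/predecessor_set_eqP => [||j] //; first by rewrite vk; exact: admissible_factor.
  apply/idP/idP => [| /w_le le_w]; first exact: le_lt_trans.
  apply: le_lt_trans (wval_factor_lt j n); apply: vmin => //.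
  by apply/wsP; exists j.
apply: inj_card_eq => i j; rewrite !inE /= => iws jws.
have /wsP[k wk] := mem_nth [::] iws; have /wsP[l wl] := mem_nth [::] jws.
rewrite wk wl => /predecessor_set_factor_inj; rewrite -wk -wl => /eqP.
by rewrite nth_uniq // => /eqP.
Qed.

End PredecessorSets.
End QuasiGreedy.
End Admissible.

(** * Values of tails of infinite sequences *)

Section TailValues.
Context {R : realType}.
Variable b : R.
Hypothesis b0 : 0 < b.
Let b0' : 0 <= b := ltW b0.

(** A relation rather than a limit operator, so that convergence is part of the claim. *)
Definition tail_value (s : nat -> nat) k (x : R) : Prop :=
  (fun n => wval b (factor s k n)) @ \oo --> x.

Lemma tail_value_unique s k x y : tail_value s k x -> tail_value s k y -> x = y.
Proof. exact: cvg_unique. Qed.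

Lemma tail_value_near s k s' k' x :
  (\forall n \near \oo, wval b (factor s k n) = wval b (factor s' k' n)) ->
  tail_value s k x -> tail_value s' k' x.
Proof. by move=> ss'; apply: cvg_trans; apply: near_eq_cvg. Qed.

Lemma tail_value_le s k x n : tail_value s k x -> wval b (factor s k n) <= x.
Proof.
move=> sx; apply: (cvgr_to_ge sx); exists n => // m /= nm.
by rewrite -(subnKC nm) factor_cat wval_le_cat.
Qed.

Lemma tail_value_ge0 s k x : tail_value s k x -> 0 <= x.
Proof. exact: (@tail_value_le s k x 0). Qed.

Lemma tail_value_up s k x y : tail_value s k x ->
  (forall n, wval b (factor s k n) <= y) -> x <= y.
Proof. by move=> sx sy; apply: (cvgr_to_le sx); exists 0%N => // n _; exact: sy. Qed.

Lemma tail_value_pred s k x :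
  tail_value s k.+1 x -> tail_value s k (((s k)%:R + x) * b).
Proof.
move=> sx; rewrite /tail_value -cvg_shiftS.
have -> : [sequence wval b (factor s k n.+1)]_n =
    fun n => ((s k)%:R + wval b (factor s k.+1 n)) * b.
  by apply/funext => n; rewrite /mk_sequence factorS wval_cons.
by apply: cvgMr_tmp; apply: cvgD => //; exact: cvg_cst.
Qed.

Lemma tail_value_succ s k x :
  tail_value s k x -> tail_value s k.+1 (x / b - (s k)%:R).
Proof.
rewrite {1}/tail_value -cvg_shiftS => sx; rewrite /tail_value.
have -> : (fun n => wval b (factor s k.+1 n)) =
    fun n => wval b (factor s k n.+1) / b - (s k)%:R.
  by apply/funext => n; rewrite factorS wval_cons mulfK ?lt0r_neq0 // addrC addKr.
by apply: cvgB; [apply: cvgMr_tmp; exact: sx | exact: cvg_cst].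
Qed.

Lemma tail_value_prefix s k x :
  tail_value s k x -> tail_value s 0 (wval b (factor s 0 k) + b ^+ k * x).
Proof.
elim: k x => [|k IH] x sx; first by rewrite expr0 mul1r add0r.
have := IH _ (tail_value_pred sx).
rewrite -[in factor _ _ k.+1]addn1 factor_cat wval_cat size_factor factorS.
by congr tail_value; rewrite wval_cons wval_nil exprS add0n; ring.
Qed.

Lemma tail_value_exists s x k : tail_value s 0 x -> exists y, tail_value s k y.
Proof.
move=> sx; elim: k => [|k [y sy]]; first by exists x.
by exists (y / b - (s k)%:R); exact: tail_value_succ.
Qed.

(** The common prefix contributes equally to [x]; subtract it and divide by [b ^+ k]. *)
Lemma tail_value_cancel s s' k x y : (forall j, (j < k)%N -> s j = s' j) ->
  tail_value s 0 x -> tail_value s' 0 x -> tail_value s k y -> tail_value s' k y.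
Proof.
move=> ss' sx s'x sy; have [z s'z] := tail_value_exists k s'x.
suff -> : y = z by [].
have := tail_value_unique (tail_value_prefix sy) sx.
rewrite -(tail_value_unique (tail_value_prefix s'z) s'x) (@eq_factor s s' 0 k ss').
by move/addrI/mulfI; apply; rewrite expf_neq0 // lt0r_neq0.
Qed.

End TailValues.

(** * Greedy expansions and the language of the beta-shift *)

Section BetaExpansions.
Context {R : realType}.
Variable beta : R.
Hypothesis beta_gt1 : 1 < beta.
Let beta_gt0 : 0 < beta := lt_trans ltr01 beta_gt1.
Let b0 : 0 < beta^-1.
Proof. by rewrite invr_gt0. Qed.

Lemma series_wval (s : nat -> nat) :
  series (fun n => (s n)%:R / beta ^+ n.+1) = fun n => wval beta^-1 (factor s 0 n).
Proof.
apply/funext; elim=> [|n IH]; first by rewrite /series /= big_geq.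
rewrite seriesSr IH -[in factor _ _ n.+1]addn1 factor_cat wval_cat size_factor factorS.
by rewrite wval_cons wval_nil addr0 exprS invfM exprVn add0n; ring.
Qed.

Lemma beta_expansionP (s : nat -> nat) x :
  beta_expansion beta x s <->
  (forall n, (s n <= Num.truncn beta)%N) /\ tail_value beta^-1 s 0 x.
Proof. by rewrite /beta_expansion series_wval. Qed.

(** The greedy algorithm: [r] is the orbit of [x] under [y -> beta y mod 1], and the error after [n]
    digits is [r n] divided by [beta ^+ n]. *)
Lemma beta_expansion_exists x : 0 <= x < 1 -> exists s, beta_expansion beta x s.
Proof.
move=> x01; pose r := fix r n := if n is n'.+1
  then beta * r n' - (Num.truncn (beta * r n'))%:R else x.
have r01 n : 0 <= r n < 1.
  elim: n => //= n /andP[rn0 rn1].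
  have /andP[le_r lt_r] := truncn_itv (mulr_ge0 (ltW beta_gt0) rn0).
  by rewrite subr_ge0 le_r ltrBlDr addrC natr1.
pose s n := Num.truncn (beta * r n).
have sr k n : wval beta^-1 (factor s k n) = r k - beta^-1 ^+ n * r (k + n)%N.
  elim: n k => [|n IH] k; first by rewrite expr0 mul1r addn0 subrr.
  rewrite factorS wval_cons IH addSnnS exprS /=.
  have : beta^-1 * beta = 1 by rewrite mulVf // lt0r_neq0.
  rewrite -/(s k); move: (beta^-1) => c cb.
  rewrite -[r k in RHS]mul1r -cb; ring.
exists s; apply/beta_expansionP; split=> [n|].
  by apply: le_truncn; have /andP[_ /ltW] := r01 n; exact: ler_piMr (ltW beta_gt0).
have b1 : `|beta^-1| < 1 by rewrite ger0_norm ?(ltW b0) // invf_lt1.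
apply/cvgrPdist_lt => eps eps0.
have /cvgrPdist_lt/(_ eps eps0) [N _ Nle] := cvg_expr b1.
exists N => // n /Nle /=; rewrite sr add0n sub0r normrN -[x]/(r 0%N) subKr.
apply: le_lt_trans; rewrite normrM ler_piMr //.
by have /andP[? /ltW] := r01 n; rewrite ger0_norm.
Qed.

(** The bound is the value of the constant sequence with the largest digit. *)
Lemma tail_value_bound s k x : tail_value beta^-1 s k x ->
  (forall n, (s n <= Num.truncn beta)%N) -> x <= (Num.truncn beta)%:R / (beta - 1).
Proof.
move=> sx sm; apply: tail_value_up sx _ => n.
have beta1 : 0 < beta - 1 by rewrite subr_gt0.
apply: (@wval_le _ _ (ltW b0) _ (Num.truncn beta)).
- by rewrite divr_ge0 ?ler0n // ltW.
- rewrite ler_pdivrMr // le_eqVlt; apply/orP; left; apply/eqP.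
  by field; rewrite lt0r_neq0.
- by apply/allP => _ /mapP[j _ ->].
Qed.

(* If some tail had value at least 1, one could raise the digit before it and
   expand the excess greedily, contradicting maximality. *)
Lemma greedy_tail_lt1 x s i :
  (Num.truncn beta)%:R < 2 * (beta - 1) -> x < 1 -> greedy_expansion beta x s ->
  exists2 y, tail_value beta^-1 s i y & y < 1.
Proof.
move=> beta2 x1 [/beta_expansionP[sm sx] smax].
elim: i => [|i [y sy y1]]; first by exists x.
have sz := tail_value_succ b0 sy; rewrite invrK in sz.
set z := _ - _ in sz; exists z => //; rewrite ltNge; apply/negP => z1.
(* This puts [z - 1] in [[0, 1)], where an expansion exists. *)
have z2 : z < 2.
  apply: le_lt_trans (tail_value_bound sz sm) _.
  by rewrite ltr_pdivrMr // subr_gt0.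
have [g /beta_expansionP[gm gz]] : exists g, beta_expansion beta (z - 1) g.
  by apply: beta_expansion_exists; rewrite subr_ge0 z1 ltrBlDr.
pose t n := if (n < i)%N then s n else if n == i then (s i).+1 else g (n - i.+1)%N.
have ti : t i = (s i).+1 by rewrite /t ltnn eqxx.
have ty : tail_value beta^-1 t i y.
  have -> : y = ((t i)%:R + (z - 1)) * beta^-1.
    by rewrite ti -natr1 /z; field; rewrite lt0r_neq0.
  apply: tail_value_pred; apply: tail_value_near gz; exists 0%N => // n _ /=.
  congr (wval _ _); apply: eq_map => j; rewrite /t add0n.
  have ij : (i < i.+1 + j)%N by rewrite addSn ltnS leq_addr.
  by rewrite ltnNge ltnW //= gtn_eqF // addKn.
have tx : tail_value beta^-1 t 0 x.
  have <- : wval beta^-1 (factor t 0 i) + beta^-1 ^+ i * y = x.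
    rewrite (@eq_factor t s) => [|j ji]; last by rewrite /t add0n ji.
    exact: tail_value_unique (tail_value_prefix sy) sx.
  exact: tail_value_prefix.
(* The raised digit is still allowed: [s i + 1 <= s i + z = y * beta <= beta]. *)
have tm n : (t n <= Num.truncn beta)%N.
  rewrite /t; case: ifP => // _; case: ifP => // _.
  rewrite truncn_ge_nat ?(ltW beta_gt0) // -natr1.
  have : z = y * beta - (s i)%:R by [].
  have : y * beta <= beta by rewrite ler_piMl // ltW.
  lra.
have [ts | [k eq_ts lt_ts]] : lexi_le t s by apply: smax; apply/beta_expansionP.
  by move: ti; rewrite ts => /n_Sn.
have [ki|ik|ki] := ltngtP k i.
- by move: lt_ts; rewrite /t ki ltnn.
- by move: (eq_ts _ ik); rewrite ti => /esym/n_Sn.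
- by move: lt_ts; rewrite ki ti ltnNge leqnSn.
Qed.

(** If a competitor [t] first differs from [s] at [k] with a larger digit, its tail there still has
    value [v k], yet [v k < (s k + 1) / beta <= t k / beta], which is at most that value. *)
Lemma tails_lt1_greedy s (v : nat -> R) :
  (forall i, tail_value beta^-1 s i (v i)) -> (forall i, v i < 1) ->
  greedy_expansion beta (v 0%N) s.
Proof.
move=> sv v1; have sm n : (s n <= Num.truncn beta)%N.
  rewrite truncn_ge_nat ?(ltW beta_gt0) // -[X in _ <= X]mul1r -ler_pdivrMr //.
  apply: le_trans (ltW (v1 n)); apply: le_trans (tail_value_le b0 1 (sv n)).
  by rewrite factorS wval_cons wval_nil addr0.
split=> [|t /beta_expansionP[tm tv]]; first exact/beta_expansionP.
have [-> | /eqP nts] := eqVneq t s; first by left.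
right; have [k0 tsk0] : exists k, t k != s k.
  apply: contra_notP nts => /forallNP ts; apply/funext => k.
  by have /negP := ts k; rewrite negbK => /eqP.
have [k tsk kmin] := ex_minnP (ex_intro (fun k => t k != s k) k0 tsk0).
have eq_ts j : (j < k)%N -> t j = s j.
  by rewrite ltnNge => kj; apply/eqP; apply: contraNT kj => /kmin.
exists k => //; case: ltngtP tsk => // st _.
have tk : tail_value beta^-1 t k (v k).
  by apply: (tail_value_cancel b0 _ (sv 0%N) tv (sv k)) => j /eq_ts.
have := tail_value_le b0 1 tk; rewrite factorS wval_cons wval_nil addr0.
rewrite (tail_value_unique (sv k) (tail_value_pred (sv k.+1))) ler_pM2r // leNgt.
by rewrite -[X in _ < X]addr0 natr_add_lt.
Qed.

(** Cylinders on finitely many coordinates are neighbourhoods in the product topology. *)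
Lemma beta_shift_prefix (x : {ptws nat -> nat}) n : beta_shift beta x ->
  exists2 s, (exists2 y, 0 <= y < 1 & greedy_expansion beta y s) &
    forall j, (j < n)%N -> s j = x j.
Proof.
move=> xX; have [] := xX [set s : {ptws nat -> nat} | forall j : 'I_n, s j = x j].
  apply: (filter_forall (nbhs_filter x)) => j.
  exact: (@proj_continuous nat (fun=> nat) j x _ (discrete_set1 (x j))).
by move=> s [sG sx]; exists s => // j jn; exact: (sx (Ordinal jn)).
Qed.

(** A word of the closure occurs in a greedy expansion, whose tails bound its suffixes. Conversely
    an admissible word followed by zeros is a greedy expansion. *)
Lemma language_beta_shiftP w : (Num.truncn beta)%:R < 2 * (beta - 1) ->
  language (beta_shift beta) w <-> admissible beta^-1 w.
Proof.
move=> beta2; split=> [[x xX [i wE]] j | aw].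
  have [s [y /andP[_ y1] sy] sx] := beta_shift_prefix (i + size w) xX.
  have -> : w = factor s i (size w).
    by rewrite {1}wE; apply: eq_factor => k kw; rewrite sx // ltn_add2l.
  rewrite drop_factor; have [z sz z1] := greedy_tail_lt1 (i + j) beta2 y1 sy.
  exact: le_lt_trans (tail_value_le b0 _ sz) z1.
(* The default value 0 supplies the padding by zeros. *)
pose s := nth 0%N w.
have sv i : tail_value beta^-1 s i (wval beta^-1 (drop i w)).
  have [k] := ubnP (size w - i); elim: k i => // k IH i; rewrite ltnS => wik.
  have [iw | wi] := ltnP i (size w); last first.
    rewrite drop_oversize // wval_nil.
    suff s0 n : wval beta^-1 (factor s i n) = 0.
      by rewrite /tail_value (funext s0); exact: cvg_cst.
    elim: n {IH wik} i wi => // n IH i wi.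
    by rewrite factorS wval_cons IH ?(leq_trans wi) // /s nth_default // addr0 mul0r.
  rewrite (drop_nth 0%N) // wval_cons; apply: tail_value_pred; apply: IH.
  by apply: leq_trans wik; rewrite subnS prednK // subn_gt0.
exists s; last by exists 0%N; rewrite -[LHS](mkseq_nth 0%N).
apply: subset_closure; exists (wval beta^-1 (drop 0 w)).
  by rewrite (wval_ge0 (ltW b0)) aw.
exact: tails_lt1_greedy sv aw.
Qed.

End BetaExpansions.

(** * Construction of the base *)

(* The base is found as the largest [b <= 1/2] at which all partial sums are at
   most 1: as these are uniformly Lipschitz in [b], the sum there equals 1. *)
Lemma exists_base {R : realType} (e : nat -> nat) :
  (2 < e 0)%N -> (forall k, 0 < e k.+1 < e 0)%N ->
  exists b : R, [/\ 0 < b, (e 0)%:R * b < 1 & tail_value b e 0 1].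
Proof.
move=> e2 ek; pose W (b : R) n := wval b (factor e 0 n).
have em n : all (fun a => a <= e 0)%N (factor e 0 n).
  apply/allP => _ /mapP[j _ ->]; rewrite add0n.
  by case: j => // j; have /andP[_ /ltnW] := ek j.
have e03 : 3 <= (e 0)%:R :> R by rewrite ler_nat.
pose E := [set b : R | 0 <= b <= 2^-1 /\ forall n, W b n <= 1].
have E0 : E 0.
  split=> [|n]; first lra.
  by rewrite /W; case: n => [|n]; rewrite ?factorS ?wval_nil ?wval_cons ?mulr0 ler01.
have Eub : has_ubound E by exists 2^-1 => b [/andP[_]].
pose c := sup E.
have c0 : 0 <= c by exact: ub_le_sup.
have c2 : c <= 2^-1 by apply: ge_sup; [exists 0 | move=> b [/andP[_]]].
have Wc n : W c n <= 1.
  rewrite leNgt; apply/negP => W1.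
  (* By the Lipschitz bound, a point of [E] within [d] of [c] would still have its partial sum above
     1. *)
  pose d := (W c n - 1) / (4 * (e 0)%:R).
  have d0 : 0 < d by rewrite divr_gt0 ?subr_gt0 // mulr_gt0 //; lra.
  have [|b Eb cb] := @sup_adherent _ E _ d0; first by split; [exists 0 |].
  have bc : b <= c by exact: ub_le_sup.
  have [/andP[b0 _] /(_ n) Wb] := Eb.
  have := wval_lipschitz b0 bc c2 (em n); rewrite -!/(W _ n).
  have : 4 * (e 0)%:R * (c - b) < 4 * (e 0)%:R * d by rewrite ltr_pM2l /c; lra.
  rewrite /d [_ * (_ / _)]mulrC divfK; last by apply/lt0r_neq0; lra.
  lra.
have Wmono : {homo W c : n m / (n <= m)%N >-> n <= m}.
  by move=> n m nm; rewrite /W -(subnKC nm) factor_cat wval_le_cat.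
have Wub : has_ubound (range (W c)) by exists 1 => _ [n _ <-].
have cl : tail_value c e 0 (sup (range (W c))) by exact: nondecreasing_cvgn.
set l := sup _ in cl.
have l_le1 : l <= 1 by apply: tail_value_up cl _.
have ec1 : (e 0)%:R * c <= 1.
  by have := Wc 1%N; rewrite /W factorS wval_cons wval_nil addr0.
(* Strictness, from [3 <= e 0], leaves room to increase [c]. *)
have c_lt2 : c < 2^-1 by nra.
have l1 : l = 1.
  apply/eqP; rewrite eq_le l_le1 leNgt; apply/negP => l_lt1.
  pose d := Num.min ((1 - l) / (4 * (e 0)%:R)) (2^-1 - c).
  have d0 : 0 < d.
    by rewrite lt_min divr_gt0 ?subr_gt0 //= mulr_gt0 //; lra.
  have dl : 4 * (e 0)%:R * d <= 1 - l.
    rewrite mulrC -ler_pdivlMr ?ge_min ?lexx // mulr_gt0 //; lra.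
  have d2 : d <= 2^-1 - c by rewrite ge_min lexx orbT.
  have : E (c + d).
    split=> [|n]; first by apply/andP; split; lra.
    have cd2 : c + d <= 2^-1 by lra.
    have ccd : c <= c + d by lra.
    have := wval_lipschitz c0 ccd cd2 (em n); rewrite -!/(W _ n).
    have : W c n <= l by exact: ub_le_sup.
    rewrite addrAC subrr add0r; lra.
  by move/(ub_le_sup Eub); rewrite -/c; lra.
rewrite l1 in cl.
have cgt0 : 0 < c.
  rewrite lt_neqAle c0 andbT; apply/negP => /eqP c0E.
  suff : (1 : R) <= 0 by rewrite ler10.
  apply: (tail_value_up cl) => n.
  by case: n => [|n]; rewrite -c0E ?factorS ?wval_nil ?wval_cons ?mulr0.
(* The positive second digit makes [e 0 * c < 1] strict. *)
exists c; split=> //; have := Wc 2%N.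
rewrite /W !factorS !wval_cons wval_nil addr0 mulrDl.
have e1 : 0 < (e 1)%:R :> R by rewrite ltr0n; have /andP[] := ek 0%N.
have : 0 < (e 1)%:R * c * c by rewrite !mulr_gt0.
lra.
Qed.

(** With base [b^-1 = e 0 + t 1], the first digit is the integer part of the base, and [3 <= e 0]
    gives the inequality required by [language_beta_shiftP]. *)
Lemma card_predecessor_sets_beta_shift {R : realType} (e : nat -> nat) :
  (2 < e 0)%N -> (forall k, 0 < e k.+1 < e 0)%N ->
  exists2 beta : R, 1 < beta & forall n (ws : seq (seq nat)), uniq ws ->
    (forall w, w \in ws <-> exists k, w = factor e k n) ->
    (predecessor_sets (beta_shift beta) n #= `I_(size ws))%card.
Proof.
move=> e2 ek; have [b [b0 eb1 e0v]] := @exists_base R e e2 ek.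
have e03 : 3 <= (e 0)%:R :> R by rewrite ler_nat.
have [t tv] := choice (fun k => tail_value_exists b0 k e0v).
have t0 : t 0%N = 1 by exact: tail_value_unique (tv 0%N) e0v.
have te k : t k = ((e k)%:R + t k.+1) * b.
  by apply: tail_value_unique (tv k) _; exact: tail_value_pred.
have tge0 k : 0 <= t k by exact: tail_value_ge0 (tv k).
have t_gt0 k : 0 < t k.
  case: k => [|k]; first by rewrite t0.
  rewrite te mulr_gt0 // ltr_wpDr // ltr0n.
  by have /andP[] := ek k.
have t_lt1 k : t k.+1 < 1.
  (* The value of the constant sequence [e 0 - 1]; it is below 1 exactly because [e 0 * b < 1]. *)
  pose C := ((e 0)%:R - 1) * b / (1 - b).
  have b1 : 0 < 1 - b by nra.
  apply: (@le_lt_trans _ _ C); last by rewrite /C ltr_pdivrMr //; nra.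
  apply: tail_value_up (tv k.+1) _ => n.
  apply: (@wval_le _ _ (ltW b0) _ (e 0).-1).
  - by rewrite /C divr_ge0 ?ltW // mulr_gt0 //; lra.
  - have -> : (e 0).-1%:R = (e 0)%:R - 1 :> R.
      by rewrite -[in RHS](ltn_predK e2) -natr1 addrK.
    rewrite le_eqVlt; apply/orP; left; apply/eqP; rewrite /C.
    by field; rewrite lt0r_neq0.
  - apply/allP => _ /mapP[j _ ->]; rewrite addSn.
    by have /andP[_] := ek (k + j)%N; case: (e 0).
have bE : b^-1 = (e 0)%:R + t 1%N.
  by apply: (mulIf (lt0r_neq0 b0)); rewrite -te t0 mulVf // lt0r_neq0.
have truncE : Num.truncn b^-1 = e 0.
  by apply: truncn_def; rewrite bE lerDl tge0 -natr1 ltrD2l t_lt1.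
exists b^-1; first by rewrite bE; have := tge0 1%N; lra.
move=> n ws Uws wsP.
apply: (card_predecessor_sets b0 te t_gt0 t0 t_lt1 _ Uws wsP) => w.
rewrite -[b in admissible b]invrK; apply: language_beta_shiftP.
  by rewrite bE; have := tge0 1%N; lra.
by rewrite truncE bE; have := tge0 1%N; have := t_gt0 1%N; lra.
Qed.

(** * Coding the given sequence *)

(** Letters become the positive digits up to [#|A|]; the first digit exceeds them all and is at
    least 3 whatever the alphabet. *)
Definition dominated_sequence (A : finType) (d : nat -> A) (k : nat) : nat :=
  if k is k'.+1 then (enum_rank (d k')).+1 else #|A|.+3.

Unset Implicit Arguments.

Theorem proposition3p14 (R : realType) (A : finType) (d : nat -> A) :
  exists2 beta : R, 1 < beta &
    forall n : nat, (0 < n)%N ->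
      predecessor_sets (beta_shift beta) n #= `I_(complexity d n + 1).
Proof.
pose code (a : A) : nat := (enum_rank a).+1.
have code_inj : injective code by move=> a a' [/val_inj/enum_rank_inj].
pose e := dominated_sequence d.
have eS k n : factor e k.+1 n = map code (mkseq (fun j => d (k + j)%N) n).
  by rewrite /mkseq -map_comp; apply: eq_map => j.
have code_lt a : (code a < #|A|.+3)%N by rewrite 2!ltnS; apply/ltnW/leqW/ltn_ord.
have [//|k|beta beta1 H] := @card_predecessor_sets_beta_shift R e.
  exact: code_lt.
exists beta => // n n0.
pose S := [set w : n.-tuple A | `[< subword d w >]]%SET.
pose ws := factor e 0 n :: [seq map code (val w) | w <- enum S].
have -> : (complexity d n + 1)%N = size ws.
  by rewrite addn1 /= size_map -cardE.
apply: H => [|w].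
  rewrite /= map_inj_uniq; last first.
    by move=> v w /(inj_map code_inj)/val_inj.
  rewrite enum_uniq andbT; apply/negP => /mapP[w _].
  (* Here [0 < n] matters: the prefix of [e] then starts with a digit that codes no letter, whereas
     for [n = 0] the empty word would be listed twice. *)
  case: n n0 w {S ws} => // n _ w; rewrite factorS.
  case/tupleP: w => a w /(congr1 (head 0%N)) /= E.
  by have := code_lt a; rewrite -E ltnn.
rewrite inE; split=> [/orP[/eqP -> | /mapP[v]] | [[|k] ->]]; first by exists 0%N.
- rewrite mem_enum inE => /asboolP[k vE] ->; exists k.+1.
  by rewrite eS [val v]vE size_tuple.
- by rewrite eqxx.
- apply/orP; right; apply/mapP; pose v := mkseq (fun j => d (k + j)%N) n.
  have sv : size v == n by rewrite size_mkseq.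
  exists (Tuple sv) => //; rewrite mem_enum inE; apply/asboolP.
  by exists k; rewrite /= size_mkseq.
Qed.
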